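(* Let $\mathcal{A}$ be a finite alphabet with $|\mathcal{A}|\ge 2$, let $a\in(0,1)$, $x>0$ and $\beta\ge 0$, and define $$g^{(a)}(n)=\begin{cases}\sqrt{n\log n}, & a\le\tfrac12,\\ n^a, & a>\tfrac12.\end{cases}$$ Then, for $\mathbb{P}$-almost every environment $\omega$, $$\varlimsup_{n\to\infty}\frac{n(1+\beta-\beta|\mathcal{A}|)-L^{(\beta)}_{\lfloor n|\mathcal{A}|-xn^a\rfloor,n}}{g^{(a)}(n)}\le\begin{cases}\dfrac{\sqrt2}{|\mathcal{A}|-1}-\dfrac1{|\mathcal{A}|}, & a\le\tfrac12,\\[2mm] \dfrac{1}{|\mathcal{A}|(|\mathcal{A}|-1)}-\beta x, & a>\tfrac12,\end{cases}$$ and $$\varliminf_{n\to\infty}\frac{n(1+\beta-\beta|\mathcal{A}|)-L^{(\beta)}_{\lfloor n|\mathcal{A}|-xn^a\rfloor,n}}{g^{(a)}(n)}\ge\begin{cases}0, & a\le\tfrac12,\\ -\beta x, & a>\tfrac12.\end{cases}$$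
   Context: Alignment model: $\eta^{\mathrm{x}}=\eta^{\mathrm{x}}_1\eta^{\mathrm{x}}_2\cdots$ and $\eta^{\mathrm{y}}=\eta^{\mathrm{y}}_1\eta^{\mathrm{y}}_2\cdots$ are two independent infinite words whose letters are chosen independently and uniformly at random from $\mathcal{A}$; their joint law is $\mathbb{P}$. The environment is $\omega_{i,j}=1$ if $\eta^{\mathrm{x}}_i=\eta^{\mathrm{y}}_j$ and $\omega_{i,j}=0$ otherwise ($i,j\ge1$). An admissible path from $(0,0)$ to $(m,n)$ is a lattice path whose increments all lie in $\{e_1,e_2,e_1+e_2\}$. For a path $\pi$ let $z(\pi)$ be the number of matches (steps $e_1+e_2$ whose endpoint $(i,j)$ has $\omega_{i,j}=1$) and $y(\pi)$ the number of gaps (steps $e_1$ or $e_2$). For a gap penalty $\beta\ge0$ (and mismatch penalty $0$), $L^{(\beta)}_{m,n}=\max_\pi\{z(\pi)-\beta y(\pi)\}$, the maximum being over all admissible paths from $(0,0)$ to $(m,n)$. *)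

(* Defs.v *)
From HB Require Import structures.
From mathcomp Require Import all_boot all_order all_algebra finmap.
From mathcomp Require Import all_classical all_reals all_analysis.

Set Implicit Arguments.
Unset Strict Implicit.
Unset Printing Implicit Defensive.

Import Order.TTheory GRing.Theory Num.Theory.
Import numFieldNormedType.Exports.

Local Open Scope classical_set_scope.
Local Open Scope ring_scope.

Section RandomWords.
Context {d : measure_display} {T : measurableType d} {R : realType}.
Variables (P : probability T R) (A : finType).

(* A carries the discrete sigma-algebra *)
Definition random_letter (X : T -> A) : Prop :=
  forall B : set A, measurable (X @^-1` B).

Definition uniform_letter (X : T -> A) : Prop :=
  forall c : A, P (X @^-1` [set c]) = ((#|A|%:R : R)^-1)%:E.

Definition mutually_independent (I : choiceType) (X : I -> T -> A) : Prop :=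
  forall (J : {fset I}) (B : I -> set A),
    P (\bigcap_(i in [set` J]) (X i @^-1` B i)) =
    (\prod_(i <- J) P (X i @^-1` B i))%E.

Definition letters (etax etay : nat -> T -> A) (k : nat + nat) : T -> A :=
  match k with inl i => etax i | inr j => etay j end.

(* Two independent words of i.i.d. uniform letters: all the letters of both
   words form one mutually independent family.  Words are indexed from 0. *)
Definition uniform_independent_words (etax etay : nat -> T -> A) : Prop :=
  [/\ forall k, random_letter (letters etax etay k),
      forall k, uniform_letter (letters etax etay k) &
      mutually_independent (letters etax etay)].

End RandomWords.

Section Alignment.
Context {A : finType}.

(* For i, j >= 1, compares the i-th letters counted from 1, which are
   u i.-1 and v j.-1 because words are indexed from 0; the values at i = 0 or
   j = 0 are irrelevant, as no diagonal step ends there. *)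
Definition environment (u v : nat -> A) (i j : nat) : bool :=
  u i.-1 == v j.-1.

Definition gap_step (p q : nat * nat) : bool :=
  (q == (p.1.+1, p.2)) || (q == (p.1, p.2.+1)).

Definition diagonal_step (p q : nat * nat) : bool :=
  q == (p.1.+1, p.2.+1).

(* A path is the sequence of the vertices it visits after (0, 0). *)
Definition admissible (m n : nat) (s : seq (nat * nat)) : bool :=
  path (fun p q => gap_step p q || diagonal_step p q) (0%N, 0%N) s
  && (last (0%N, 0%N) s == (m, n)).

(* pairmap f p0 [:: p1; p2; ...] = [:: f p0 p1; f p1 p2; ...] *)
Definition matches (omega : nat -> nat -> bool) (s : seq (nat * nat)) : nat :=
  count id (pairmap (fun p q => diagonal_step p q && omega q.1 q.2)
                    (0%N, 0%N) s).

Definition gaps (s : seq (nat * nat)) : nat :=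
  count id (pairmap gap_step (0%N, 0%N) s).

End Alignment.

Section Score.
Context {R : realType}.

Definition score (beta : R) (omega : nat -> nat -> bool)
    (s : seq (nat * nat)) : R :=
  (matches omega s)%:R - beta * (gaps s)%:R.

(* The supremum is a maximum: see optimal_score_max. *)
Definition optimal_score (beta : R) (omega : nat -> nat -> bool)
    (m n : nat) : R :=
  sup [set score beta omega s | s in [set s | admissible m n s]].

Lemma path_size_bound (p : nat * nat) (s : seq (nat * nat)) :
  path (fun p q => gap_step p q || diagonal_step p q) p s ->
  (size s + (p.1 + p.2) <= (last p s).1 + (last p s).2)%N.
Proof.
elim: s p => [|q s IH] p //= /andP[st /IH]; apply: leq_trans.
rewrite addSnnS leq_add2l.
by case/orP: st => [/orP[]|] /eqP -> /=; rewrite ?addSn ?addnS.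
Qed.

Lemma admissible_exists (m n : nat) : exists s, admissible m n s.
Proof.
elim: m => [|m [s /andP[ps /eqP ls]]].
  elim: n => [|n [s /andP[ps /eqP ls]]]; first by exists [::].
  exists (rcons s (0%N, n.+1)).
  by rewrite /admissible rcons_path ps ls last_rcons /gap_step /= !eqxx ?orbT.
exists (rcons s (m.+1, n)).
by rewrite /admissible rcons_path ps ls last_rcons /gap_step /= !eqxx.
Qed.

Lemma optimal_score_max (beta : R) (omega : nat -> nat -> bool) (m n : nat) :
  (exists2 s, admissible m n s & optimal_score beta omega m n =
                                 score beta omega s) /\
  (forall s, admissible m n s ->
     score beta omega s <= optimal_score beta omega m n).
Proof.
pose N := (m + n).+1.
pose f (z : 'I_N * 'I_N) : R := (z.1 : nat)%:R - beta * (z.2 : nat)%:R.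
pose Q z := `[< exists2 s, admissible m n s & score beta omega s = f z >].
have sQ s : admissible m n s -> exists2 z, Q z & score beta omega s = f z.
  move=> As; have sz : (size s <= m + n)%N.
    move: As; rewrite /admissible => /andP[/path_size_bound + /eqP ls].
    by rewrite ls /= !addn0.
  have zN : (matches omega s < N)%N.
    by rewrite ltnS; apply: leq_trans (count_size _ _) _; rewrite size_pairmap.
  have yN : (gaps s < N)%N.
    by rewrite ltnS; apply: leq_trans (count_size _ _) _; rewrite size_pairmap.
  by exists (Ordinal zN, Ordinal yN) => //; apply/asboolP; exists s.
have [s0 /sQ[z0 Qz0 _]] := admissible_exists m n.
case: (@arg_maxP _ _ _ z0 Q f Qz0) => z /asboolP[s As sz] zmax.
have ub t : admissible m n t -> score beta omega t <= score beta omega s.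
  by move=> /sQ[z' Qz' ->]; rewrite sz; exact: zmax.
suff -> : optimal_score beta omega m n = score beta omega s by split=> //; exists s.
apply/eqP; rewrite eq_le; apply/andP; split.
  apply: ge_sup; first by exists (score beta omega s), s.
  by move=> _ [t /= At <-]; exact: ub.
apply: ub_le_sup; last by exists s.
by exists (score beta omega s) => _ [t /= At <-]; exact: ub.
Qed.

Definition scale (a : R) (n : nat) : R :=
  if a <= 2^-1 then Num.sqrt (n%:R * ln n%:R) else n%:R `^ a.

(* Num.truncn is the floor, except that it sends negative reals to 0; with
   k = |A| >= 2 and a < 1 this affects only finitely many n. *)
Definition endpoint (k : nat) (a x : R) (n : nat) : nat :=
  Num.truncn (n%:R * k%:R - x * n%:R `^ a).

Definition normalized_deficit (k : nat) (a x beta : R)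
    (omega : nat -> nat -> bool) (n : nat) : R :=
  (n%:R * (1 + beta - beta * k%:R)
     - optimal_score beta omega (endpoint k a x n) n) / scale a n.

End Score.

(* Main.v *)
Require Import Defs.
From HB Require Import structures.
From mathcomp Require Import all_boot all_order all_algebra finmap.
From mathcomp Require Import all_classical all_reals all_analysis.
From mathcomp Require Import zify ring lra.

(** Write K for the size of the alphabet, m for the endpoint in the first word
    and z, D, y for the numbers of matches, diagonal steps and gaps of a path
    to (m, n).  Since y = m + n - 2 D, the deficit of the path is
      (n - z) + 2 beta (n - D) + beta (m - n K),
    and z <= D <= n.  As m is within 1 of n K - x n^a for large n, dropping the
    first two terms gives the lower bound, for every pair of words
    ([optimal_score_le], [near_normalized_deficit_ge]).

    For the upper bound it is enough to find, for a prescribed c > 0 and all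
    large n, a path with D = n and at most c g(n) mismatched diagonals, where g
    is the normalization ([aligned], [optimal_score_ge]).  The greedy path,
    which matches each letter of the second word with its next occurrence in
    the first, consumes a sum of n geometric waiting times of mean K.  The
    letters that it may lack, x n^a because of the endpoint and O(g(n)) because
    of fluctuations, have to be saved at a small cost in mismatches.  A single
    mismatch can save about K M letters, with M arbitrarily large: if the next
    M letters of the second word are a b ... b with a <> b, while the next M
    letters of the first word are all b, then mismatching a aligns the two
    blocks at once, whereas the greedy path spends those M letters on waiting
    for a and only then starts on its M geometric waiting times.  Cut the
    second word into blocks of length M: each block is such an occasion with
    probability p = K^(-2M), so that linearly many occasions are available and
    c g(n) of them, with M c large, save enough.

    The probability of failure is estimated by an exponential moment.  For
    E >= 1 let [rate E] be the number such that E is the mean of rate^(-tau)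
    for a geometric waiting time tau of parameter 1/K; the greedy path then
    fails to accommodate n letters within m letters with probability at most
    E^n rate^m.  Each use of the trick gains a factor E^(-M), so that allowing
    s mismatches multiplies the bound by
    E^(-M s) + 2^s (1 - p/2)^H, where H is the number of blocks
    ([mean_miss_blocks]).  With E = exp(2 sqrt(log n / n)) this is at most
    2 / n^2 ([mean_miss_tail]), and the Borel-Cantelli lemma concludes. *)

Set Implicit Arguments.
Unset Strict Implicit.
Unset Printing Implicit Defensive.

Import Order.TTheory GRing.Theory Num.Theory.
Import numFieldNormedType.Exports.

Local Open Scope classical_set_scope.
Local Open Scope ring_scope.

(** * Paths, alignments and scores *)

Definition lattice_step (p q : nat * nat) : bool :=
  gap_step p q || diagonal_step p q.

(** The witness is the number of diagonal steps: both coordinates together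
    grow by 1 along a gap and by 2 along a diagonal. *)
Lemma lattice_path_counts (omega : nat -> nat -> bool) (p : nat * nat)
    (s : seq (nat * nat)) : path lattice_step p s ->
  exists2 D : nat,
    (count id (pairmap (fun p q => diagonal_step p q && omega q.1 q.2) p s)
       <= D)%N &
    (D + p.2 <= (last p s).2)%N /\
    ((last p s).1 + (last p s).2 =
       p.1 + p.2 + count id (pairmap gap_step p s) + D.*2)%N.
Proof.
elim: s p => [|q s IH] [i j] /=; first by move=> _; exists 0%N => //; lia.
case/andP => st /IH[D]; move: (count _ _) (count _ _) => z y zD [Dj tot].
have : q = (i.+1, j) \/ q = (i, j.+1) \/ q = (i.+1, j.+1).
  by case/orP: st => [/orP[]|] /eqP; tauto.
move=> {st} [|[]] Eq; subst q; rewrite /gap_step /diagonal_step /= in Dj tot *.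
- have -> : ((i.+1, j) == (i.+1, j.+1)) = false by apply/eqP => -[]; lia.
  by exists D; rewrite ?eqxx ?orbT //=; move: (last _ _) Dj tot => [l1 l2] /=; lia.
- have -> : ((i, j.+1) == (i.+1, j.+1)) = false by apply/eqP => -[]; lia.
  by exists D; rewrite ?eqxx ?orbT //=; move: (last _ _) Dj tot => [l1 l2] /=; lia.
- have -> : ((i.+1, j.+1) == (i.+1, j)) = false by apply/eqP => -[]; lia.
  have -> : ((i.+1, j.+1) == (i, j.+1)) = false by apply/eqP => -[]; lia.
  exists D.+1; rewrite ?eqxx //=; first by case: (omega _ _) => /=; lia.
  by move: (last _ _) Dj tot => [l1 l2] /=; lia.
Qed.

Lemma optimal_score_le (R : realType) (beta : R) (omega : nat -> nat -> bool)
    (m n : nat) : 0 <= beta ->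
  optimal_score beta omega m n <= n%:R - beta * (m%:R - n%:R).
Proof.
move=> beta0; have [[s /andP[ps /eqP ls] ->] _] := optimal_score_max beta omega m n.
have [D zD [Dn tot]] := lattice_path_counts omega ps.
rewrite ls /= !addn0 !add0n in Dn tot.
rewrite /score /matches /gaps.
move: zD tot; set z := count _ _; set y := count _ _ => zD tot.
have -> : m%:R - n%:R = y%:R - 2 * (n%:R - D%:R) :> R.
  apply/eqP; rewrite subr_eq -subr_eq; apply/eqP.
  have /(congr1 (fun k => k%:R : R)) := tot; rewrite -addnn !natrD; lra.
have zn : z%:R <= n%:R :> R by rewrite ler_nat (leq_trans zD).
have Dn' : D%:R <= n%:R :> R by rewrite ler_nat.
have := mulr_ge0 beta0 (_ : 0 <= n%:R - D%:R); rewrite subr_ge0 => /(_ Dn').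
lra.
Qed.

(** [aligned s u v]: there is a path through [u] and [v] that meets every letter
    of [v] on a diagonal step, all but at most [s] of these steps being matches.
    The letters of [u] that are left over are gaps. *)
Inductive aligned (A : Type) : nat -> seq A -> seq A -> Prop :=
| aligned_nil s : aligned s [::] [::]
| aligned_skip s c u v : aligned s u v -> aligned s (c :: u) v
| aligned_match s c u v : aligned s u v -> aligned s (c :: u) (c :: v)
| aligned_mismatch s c d u v : aligned s u v -> aligned s.+1 (c :: u) (d :: v).

Definition word (A : Type) (w : nat -> A) (n : nat) : seq A :=
  [seq w i | i <- iota 0 n].

Lemma gap_right i j : gap_step (i, j) (i.+1, j).
Proof. by rewrite /gap_step eqxx. Qed.

Lemma gap_diagonal i j : gap_step (i, j) (i.+1, j.+1) = false.
Proof. by apply/negbTE/negP => /orP[] /eqP []; lia. Qed.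

(** The words are followed along their suffixes, starting at the lattice point
    (i, j), because the environment reads them at absolute positions. *)
Lemma aligned_path (A : finType) (x y : nat -> A) (s : nat) (u v : seq A) :
  aligned s u v -> forall i j,
  u = [seq x k | k <- iota i (size u)] -> v = [seq y k | k <- iota j (size v)] ->
  exists s' : seq (nat * nat),
  [/\ path lattice_step (i, j) s',
      last (i, j) s' = (i + size u, j + size v)%N,
      (size v <= count id (pairmap (fun p q => diagonal_step p q &&
                    environment x y q.1 q.2) (i, j) s') + s)%N &
      (count id (pairmap gap_step (i, j) s') + size v = size u)%N].
Proof.
elim=> {s u v} [s|s c u v _ IH|s c u v _ IH|s c d u v _ IH] i j /=.
- by exists [::]; rewrite /= !addn0.
- move=> [_ Eu] Ev; have [s' [ps ls ms gs]] := IH _ _ Eu Ev.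
  exists ((i.+1, j) :: s'); split=> /=.
  + by rewrite ps /lattice_step gap_right.
  + by rewrite ls addSnnS.
  + by lia.
  + by rewrite gap_right; lia.
- move=> [Ex Eu] [Ey Ev]; have [s' [ps ls ms gs]] := IH _ _ Eu Ev.
  exists ((i.+1, j.+1) :: s'); split=> /=.
  + by rewrite ps /lattice_step /diagonal_step /= eqxx orbT.
  + by rewrite ls !addSnnS.
  + by rewrite {1}/diagonal_step {1}/environment /= -Ex -Ey !eqxx /=; lia.
  + by rewrite gap_diagonal; lia.
- move=> [Ex Eu] [Ey Ev]; have [s' [ps ls ms gs]] := IH _ _ Eu Ev.
  exists ((i.+1, j.+1) :: s'); split=> /=.
  + by rewrite ps /lattice_step /diagonal_step /= eqxx orbT.
  + by rewrite ls !addSnnS.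
  + by lia.
  + by rewrite gap_diagonal; lia.
Qed.

Lemma optimal_score_ge (R : realType) (A : finType) (beta : R) (x y : nat -> A)
    (s m n : nat) : aligned s (word x m) (word y n) ->
  n%:R - s%:R - beta * (m%:R - n%:R) <=
  optimal_score beta (environment x y) m n.
Proof.
move=> al; have := aligned_path (i := 0%N) (j := 0%N) al.
rewrite !size_map !size_iota => /(_ x y erefl erefl) [s' [ps ls ms gs]].
have [_ ub] := optimal_score_max beta (environment x y) m n.
have : admissible m n s' by rewrite /admissible ls eqxx andbT.
move=> /ub; apply: le_trans; rewrite /score /matches /gaps.
move: ms gs; set z := count _ _; set g := count _ _ => ms gs.
have -> : m%:R = g%:R + n%:R :> R by rewrite -natrD gs.
have : n%:R <= z%:R + s%:R :> R by rewrite -natrD ler_nat.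
lra.
Qed.

(** * Averages over uniform words *)

Section UniformMean.
Context {R : realType} {A : finType}.
Implicit Types (f g : seq A -> R) (u v w : seq A).

(** Expectation under the uniform law on words of length [m].  The recursion on
    the first letter is what an exploration of the word uses. *)
Fixpoint mean (m : nat) f : R :=
  if m is m'.+1 then #|A|%:R^-1 * \sum_(c : A) mean m' (fun u => f (c :: u))
  else f [::].

Lemma ler_mean m f g :
  (forall u, size u = m -> f u <= g u) -> mean m f <= mean m g.
Proof.
elim: m f g => [|m IH] f g fg /=; first exact: fg.
rewrite ler_wpM2l ?invr_ge0// ler_sum// => c _.
by apply: IH => u su; apply: fg; rewrite /= su.
Qed.

Lemma eq_mean m f g :
  (forall u, size u = m -> f u = g u) -> mean m f = mean m g.
Proof. by move=> fg; apply/eqP; rewrite eq_le !ler_mean// => u /fg ->. Qed.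

Lemma mean_cst m (r : R) : (0 < #|A|)%N -> mean m (fun=> r) = r.
Proof.
move=> A0; elim: m => [//|m IH] /=; under eq_bigr do rewrite IH.
by rewrite sumr_const -[r *+ _]mulr_natl mulKf// pnatr_eq0 -lt0n.
Qed.

Lemma meanD m f g : mean m (fun u => f u + g u) = mean m f + mean m g.
Proof.
elim: m f g => [//|m IH] f g /=; rewrite -mulrDr -big_split /=.
by congr (_ * _); apply: eq_bigr => c _; rewrite IH.
Qed.

Lemma meanZ m (r : R) f : mean m (fun u => r * f u) = r * mean m f.
Proof.
elim: m f => [//|m IH] f /=; rewrite mulrCA; congr (_ * _).
by rewrite mulr_sumr; apply: eq_bigr => c _; rewrite IH.
Qed.

Lemma mean_sum m (I : finType) (F : I -> seq A -> R) :
  mean m (fun u => \sum_i F i u) = \sum_i mean m (F i).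
Proof.
elim: m F => [//|m IH] F /=; rewrite -mulr_sumr exchange_big /=.
by congr (_ * _); apply: eq_bigr => c _; rewrite IH.
Qed.

Lemma mean_cat m n f :
  mean (m + n) f = mean m (fun u => mean n (fun v => f (u ++ v))).
Proof.
elim: m f => [//|m IH] f; rewrite addSn /=; congr (_ * _).
by apply: eq_bigr => c _; rewrite IH.
Qed.

Lemma mean_exchange m n (F : seq A -> seq A -> R) :
  mean m (fun u => mean n (F u)) = mean n (fun v => mean m (F^~ v)).
Proof.
elim: m F => [//|m IH] F /=; rewrite meanZ mean_sum; congr (_ * _).
by apply: eq_bigr => c _; rewrite IH.
Qed.

Lemma mean_singleton w : mean (size w) (fun u => (u == w)%:R) = #|A|%:R ^- size w.
Proof.
elim: w => [|c w IH] /=; first by rewrite expr0 invr1.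
rewrite (bigD1 c)//= big1 ?addr0 => [|d /negbTE dc].
  under eq_mean do rewrite eqseq_cons eqxx /=.
  by rewrite IH exprS invfM.
under eq_mean do rewrite eqseq_cons dc /=.
by rewrite mean_cst//; apply/card_gt0P; exists c.
Qed.

End UniformMean.

(** * Probability that no good alignment exists *)

Section Exploration.
Context {R : realType} {A : finType}.
Variables (E : R).
Hypotheses (A2 : (2 <= #|A|)%N) (E1 : 1 <= E).
Implicit Types (u v w : seq A).

Local Notation K := (#|A|%:R : R).

Let A0 : (0 < #|A|)%N. Proof. exact: ltnW. Qed.
Let K2 : 2 <= K. Proof. by rewrite (ler_nat _ 2). Qed.
Let K0 : 0 < K. Proof. exact: lt_le_trans K2. Qed.
Let E0 : 0 < E. Proof. exact: lt_le_trans E1. Qed.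

(** The mean of E^(-X) for a Bernoulli variable X of parameter 1/K: each letter
    of the first word matches the current letter of the second one with
    probability 1/K.  Hence E^(n - N) rate^(-i) is a martingale, where N is the
    number of matches within the first i letters. *)
Definition rate : R := 1 - (1 - E^-1) / K.

Lemma rateM : K * rate = K - 1 + E^-1.
Proof. by rewrite /rate; field; rewrite !gt_eqF. Qed.

Lemma rate_gt0 : 0 < rate.
Proof.
have := rateM; have : 0 < E^-1 by rewrite invr_gt0.
have h2 := K2; move=> Ei Kr;  rewrite -(pmulr_rgt0 _ K0) Kr; lra.
Qed.

Lemma rate_le1 : rate <= 1.
Proof.
have : E^-1 <= 1 by rewrite invf_le1.
have h2 := K2; move=> Ei;  rewrite -(ler_pM2l K0) rateM; lra.
Qed.

Definition misaligned (s : nat) u v : R := (~~ `[< aligned s u v >])%:R.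

Lemma misaligned_mono s t u v u' v' : (aligned s u v -> aligned t u' v') ->
  misaligned t u' v' <= misaligned s u v.
Proof.
rewrite /misaligned => h; case: asboolP => [_|n]; first by case: asboolP.
by case: asboolP => // /h.
Qed.

(** Given [u], the probability that [u] admits no alignment with the known block
    [w] followed by [n] uniform letters. *)
Definition miss (s : nat) w (n : nat) u : R :=
  mean n (fun v => misaligned s u (w ++ v)).

Lemma miss_le1 s w n u : miss s w n u <= 1.
Proof.
rewrite -[leRHS](mean_cst n _ A0); apply: ler_mean => v _.
by rewrite /misaligned; case: asboolP.
Qed.

Lemma miss_skip s w n u0 u : miss s w n (u0 ++ u) <= miss s w n u.
Proof.
apply: ler_mean => v _; apply: misaligned_mono => al.
by elim: u0 => [//|c u0 IH] /=; apply: aligned_skip.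
Qed.

Lemma miss_match s c w n u : miss s (c :: w) n (c :: u) <= miss s w n u.
Proof. by apply: ler_mean => v _; apply: misaligned_mono; apply: aligned_match. Qed.

(** The cheap move: one mismatch buys the alignment of a whole block. *)
Lemma miss_mismatch s a b k n u :
  miss s.+1 (a :: nseq k b) n (nseq k.+1 b ++ u) <= miss s [::] n u.
Proof.
apply: ler_mean => v _; apply: misaligned_mono => al /=.
by apply: aligned_mismatch; elim: k => [//|k IH] /=; apply: aligned_match.
Qed.

(** Each letter waited for costs a factor [E].  With [u] = d :: u', the letter is
    met if d = c and the wait goes on otherwise, and [rateM] balances the two
    cases.  The bound has to be at least 1 for an empty [u], whence 1 <= C. *)
Lemma mean_miss_greedy s n (C : R) : 1 <= C ->
  (forall m, mean m (miss s [::] n) <= C * rate ^+ m) ->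
  forall w m, mean m (miss s w n) <= C * E ^+ size w * rate ^+ m.
Proof.
move=> C1 HC; elim=> [|c w IHw] m; first by rewrite expr0 mulr1.
have CE k : 1 <= C * E ^+ k by rewrite mulr_ege1// exprn_ege1.
elim: m => [|m IHm] /=.
  by rewrite expr0 mulr1 (le_trans (miss_le1 _ _ _ _))// CE.
rewrite -(ler_pM2l K0) mulVKf ?gt_eqF// (bigD1 c)//=.
set X := C * E ^+ size w * rate ^+ m.
have X1 : mean m (fun u => miss s (c :: w) n (c :: u)) <= X.
  by apply: le_trans (IHw m); apply: ler_mean => u _; exact: miss_match.
have -> : K * (C * E ^+ (size w).+1 * rate ^+ m.+1) = X + (K - 1) * (E * X).
  rewrite /X !exprS; transitivity (C * (E * E ^+ size w) * (K * rate) * rate ^+ m).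
    by ring.
  by rewrite rateM; field; rewrite gt_eqF.
apply: lerD => //.
have -> : K - 1 = #|[pred d : A | d != c]|%:R.
  by rewrite cardC1 -subn1 natrB.
rewrite mulr_natl -sumr_const; apply: ler_sum => d _.
have -> : E * X = C * E ^+ (size w).+1 * rate ^+ m by rewrite /X exprS; ring.
by apply: le_trans IHm; apply: ler_mean => u _; exact: (miss_skip _ _ _ [:: d]).
Qed.

(** One block of length M = k + 1, given bounds for what follows the block: [C]
    after a mismatch has been spent, [C'] before. *)
Section Block.
Variables (s n k : nat) (C C' : R) (a b : A).
Hypotheses (C1 : 1 <= C) (C'1 : 1 <= C') (CC' : C <= C' * E ^+ k.+1).
Hypothesis (ab : a != b).
Hypothesis HC : forall m, mean m (miss s [::] n) <= C * rate ^+ m.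
Hypothesis HC' : forall m, mean m (miss s.+1 [::] n) <= C' * rate ^+ m.

Let G := C' * E ^+ k.+1.

(** The first word is explored as long as it reads b.  Any other letter brings
    back the greedy strategy, for which the letters read so far are lost anyway
    since it is still waiting for a.  Each further b multiplies by 1/K the
    advantage G - C, which is collected after M of them. *)
Lemma mean_miss_pattern m :
  mean m (miss s.+1 (a :: nseq k b) n) <=
  (G - K ^- k.+1 * (G - C)) * rate ^+ m.
Proof.
set W := a :: nseq k b.
(* i is the number of letters b that remain to be read. *)
suff H i : (i <= k.+1)%N -> forall m,
    mean m (fun u => miss s.+1 W n (nseq (k.+1 - i) b ++ u)) <=
    (G - K ^- i * (G - C)) * rate ^+ m.
  by have := H _ (leqnn _) m; rewrite subnn.
elim: i {m} => [_|i IH ik] m.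
  rewrite subn0 expr0 invr1 mul1r subKr; apply: le_trans (HC m).
  by apply: ler_mean => u _; exact: miss_mismatch.
set t := K ^- i in IH; have -> : K ^- i.+1 = t / K by rewrite exprSr invfM mulrC.
have t0 : 0 <= t by rewrite invr_ge0 exprn_ge0// ltW.
have t1 : t <= 1 by rewrite invf_le1 ?exprn_gt0// exprn_ege1// (le_trans _ K2)// ler1n.
have tK1 : t / K <= 1 by rewrite ler_pdivrMr// mul1r (le_trans t1)// (le_trans _ K2)// ler1n.
have GC : 0 <= G - C by rewrite subr_ge0.
case: m => [|m] /=.
  rewrite expr0 mulr1 (le_trans (miss_le1 _ _ _ _))//.
  have : t / K * (G - C) <= 1 * (G - C) by rewrite ler_wpM2r.
  by move: C1; lra.
set Y := rate ^+ m.
have Y0 : 0 <= Y by rewrite exprn_ge0// ltW// rate_gt0.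
have -> : (k.+1 - i.+1 = k - i)%N by [].
rewrite -(ler_pM2l K0) mulVKf ?gt_eqF// (bigD1 b)//= (bigD1 a)//=.
have Hb : mean m (fun u => miss s.+1 W n (nseq (k - i) b ++ b :: u)) <=
    (G - t * (G - C)) * Y.
  have <- : mean m (fun u => miss s.+1 W n (nseq (k.+1 - i) b ++ u)) =
      mean m (fun u => miss s.+1 W n (nseq (k - i) b ++ b :: u)).
    apply: eq_mean => u _; rewrite subSn//; congr miss.
    by elim: (k - i)%N => [//|j IHj] /=; congr cons.
  by apply: IH; exact: ltnW.
have Ha : mean m (fun u => miss s.+1 W n (nseq (k - i) b ++ a :: u)) <=
    G / E * Y.
  have -> : G / E = C' * E ^+ k.
    by rewrite /G exprSr mulrA mulfK// gt_eqF.
  rewrite -[k in E ^+ k](size_nseq k b).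
  apply: le_trans (mean_miss_greedy C'1 HC' _ m); apply: ler_mean => u _.
  exact: le_trans (miss_skip _ _ _ _ _) (miss_match _ _ _ _ _).
have Hd : \sum_(d | (d != b) && (d != a))
      mean m (fun u => miss s.+1 W n (nseq (k - i) b ++ d :: u)) <=
    (K - 2) * (G * Y).
  have -> : K - 2 = #|[pred d : A | (d != b) && (d != a)]|%:R.
    have := cardC (pred2 b a); rewrite card2 eq_sym ab /= => cA.
    rewrite -cA natrD addrAC subrr add0r; congr (_%:R).
    by apply: eq_card => d; rewrite !inE negb_or.
  rewrite mulr_natl -sumr_const; apply: ler_sum => d _.
  have -> : G * Y = C' * E ^+ size W * Y by rewrite /= size_nseq.
  apply: le_trans (mean_miss_greedy C'1 HC' _ m); apply: ler_mean => u _.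
  by rewrite -cat1s catA; exact: miss_skip.
apply: le_trans (lerD Hb (lerD Ha Hd)) _.
rewrite exprS -/Y.
have -> : K * ((G - t / K * (G - C)) * (rate * Y)) =
    ((K * rate) * G - rate * (t * (G - C))) * Y.
  by field; rewrite gt_eqF.
rewrite rateM.
have : (1 - rate) * (t * (G - C)) * Y >= 0.
  by rewrite !mulr_ge0// subr_ge0 rate_le1.
lra.
Qed.

(** The special block has probability K^(-M); any other one is matched greedily. *)
Lemma mean_miss_block m :
  mean m (miss s.+1 [::] (k.+1 + n)) <=
  ((1 - K ^- (k.+1).*2) * G + K ^- (k.+1).*2 * C) * rate ^+ m.
Proof.
set W := a :: nseq k b; set Y := rate ^+ m.
have -> : mean m (miss s.+1 [::] (k.+1 + n)) =
    mean k.+1 (fun w => mean m (miss s.+1 w n)).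
  rewrite -mean_exchange; apply: eq_mean => u _.
  by rewrite /miss mean_cat.
have sW : size W = k.+1 by rewrite /= size_nseq.
have -> : ((1 - K ^- (k.+1).*2) * G + K ^- (k.+1).*2 * C) * Y =
    mean k.+1 (fun w => G * Y + (- (K ^- k.+1 * (G - C) * Y)) * (w == W)%:R).
  rewrite meanD mean_cst// meanZ -sW mean_singleton sW.
  rewrite -addnn exprD invfM; ring.
apply: ler_mean => w sw; case: eqVneq => [->|_].
  by rewrite mulr1; have := mean_miss_pattern m; rewrite -/Y -/W mulrBl.
rewrite mulr0 addr0; have := mean_miss_greedy C'1 HC' w m.
by rewrite sw.
Qed.

End Block.

Lemma mean_miss_plain s n m : mean m (miss s [::] n) <= E ^+ n * rate ^+ m.
Proof.
rewrite mean_exchange -[leRHS](mean_cst n _ A0); apply: ler_mean => v <-.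
have := mean_miss_greedy (s := s) (n := 0%N) (lexx 1) _ v m.
rewrite mul1r /miss /= cats0; apply => j.
apply: (@le_trans _ _ 0); last by rewrite mul1r exprn_ge0// ltW// rate_gt0.
rewrite -[leRHS](mean_cst j _ A0); apply: ler_mean => u _.
rewrite /misaligned asboolT//.
by elim: u => [|c u IH]; [exact: aligned_nil | exact: aligned_skip].
Qed.

(** By [mean_miss_block] the bound, divided by E^(number of letters), has to
    dominate the mean of L^(- min(s, N)), where L = E^M and N is binomial with
    parameters H and p.  On N >= s this is L^(-s), and Markov's inequality for
    2^(-N) gives the other term, 2^s (1 - p/2)^H. *)
Lemma mean_miss_blocks (k n0 : nat) (H s m : nat) :
  let p := K ^- (k.+1).*2 in
  mean m (miss s [::] (H * k.+1 + n0)) <=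
  E ^+ (H * k.+1 + n0) * (E ^- (k.+1 * s) + 2 ^+ s * (1 - p / 2) ^+ H) *
  rate ^+ m.
Proof.
cbv zeta; set p := K ^- (k.+1).*2.
have /card_gt1P[a [b [_ _ ab]]] : (1 < #|A|)%N by [].
have p0 : 0 < p by rewrite invr_gt0 exprn_gt0.
have p1 : p <= 1.
  by rewrite invf_le1 ?exprn_gt0// exprn_ege1// (le_trans _ K2)// ler1n.
set q := 1 - p / 2; have q0 : 0 < q by rewrite /q; lra.
set L := E ^+ k.+1; have L1 : 1 <= L by rewrite exprn_ege1.
have L0 : 0 < L by exact: lt_le_trans L1.
set B := fun H s => L ^- s + 2 ^+ s * q ^+ H.
have B0 h t : 0 <= L ^- t <= B h t.
  by rewrite lerDl invr_ge0 !mulr_ge0 ?exprn_ge0// ltW.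
have B1 h t : 1 <= E ^+ (h * k.+1 + n0) * B h t.
  rewrite exprD mulnC exprM -/L mulrAC mulr_ege1//; last exact: exprn_ege1.
  have [th|ht] := leqP t h.
    apply: (@le_trans _ _ (L ^+ h * L ^- t)).
      by rewrite ler_pdivlMr ?exprn_gt0// mul1r ler_weXn2l.
    apply: ler_wpM2l; first by rewrite exprn_ge0// ltW.
    by case/andP: (B0 h t).
  apply: mulr_ege1; first by rewrite exprn_ege1.
  apply: (@le_trans _ _ ((2 * q) ^+ h)); first by rewrite exprn_ege1// /q; lra.
  rewrite /B exprMn; apply: (@le_trans _ _ (2 ^+ t * q ^+ h)).
    by rewrite ler_pM2r ?exprn_gt0// ler_weXn2l ?ler1n// ltnW.
  by rewrite lerDr invr_ge0 exprn_ge0// ltW.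
rewrite exprM -/L -/(B H s).
have base h t m' : (h = 0 \/ t = 0)%N ->
    mean m' (miss t [::] (h * k.+1 + n0)) <=
    E ^+ (h * k.+1 + n0) * B h t * rate ^+ m'.
  move=> ht; apply: le_trans (mean_miss_plain _ _ _) _.
  rewrite ler_wpM2r ?exprn_ge0 ?(ltW rate_gt0)// ler_peMr ?exprn_ge0 ?(ltW E0)//.
  case: ht => ->; rewrite /B expr0.
    rewrite mulr1 (@le_trans _ _ (2 ^+ t))// ?exprn_ege1 ?ler1n//.
    by rewrite lerDr invr_ge0 exprn_ge0// ltW.
  by rewrite invr1 mul1r lerDl exprn_ge0// ltW.
elim: H s m => [|H IH] s m; first by apply: base; left.
case: s => [|s]; first by apply: base; right.
have HB : B H s <= B H s.+1 * L.
  rewrite /B mulrDl exprSr invfM -mulrA mulVf ?gt_eqF// mulr1 lerD2l.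
  rewrite -[leLHS]mulr1 ler_pM ?mulr_ge0 ?exprn_ge0 ?(ltW q0)//.
  by rewrite ler_wpM2r ?exprn_ge0 ?(ltW q0)// ler_weXn2l// ler1n.
rewrite mulSn -addnA; set N := (H * k.+1 + n0)%N.
have IH' t m' : mean m' (miss t [::] N) <= E ^+ N * B H t * rate ^+ m' by exact: IH.
have CC : E ^+ N * B H s <= E ^+ N * B H s.+1 * E ^+ k.+1.
  by rewrite -[leRHS]mulrA ler_wpM2l// exprn_ge0// ltW.
apply: le_trans (mean_miss_block (B1 H s) (B1 H s.+1) CC ab (IH' s) (IH' s.+1) m) _.
rewrite ler_wpM2r ?exprn_ge0 ?(ltW rate_gt0)//.
rewrite -/p -/L [E ^+ (k.+1 + N)]exprD -/L.
have -> : (1 - p) * (E ^+ N * B H s.+1 * L) + p * (E ^+ N * B H s) =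
  L * E ^+ N * ((1 - p) * B H s.+1 + p * (B H s / L)).
  by field; rewrite gt_eqF.
rewrite ler_wpM2l ?mulr_ge0 ?exprn_ge0 ?(ltW L0) ?(ltW E0)//.
have -> : B H s / L = L ^- s.+1 + 2 ^+ s * q ^+ H / L.
  by rewrite /B mulrDl exprSr invfM mulrC.
have X0 : 0 <= 2 ^+ s * q ^+ H by rewrite mulr_ge0 ?exprn_ge0 ?(ltW q0).
have XL : 2 ^+ s * q ^+ H / L <= 2 ^+ s * q ^+ H.
  by rewrite ler_pdivrMr// ler_peMr.
have pXL : p * (2 ^+ s * q ^+ H / L) <= p * (2 ^+ s * q ^+ H).
  by rewrite ler_wpM2l// ltW.
rewrite /B [2 ^+ s.+1]exprS [q ^+ H.+1]exprS; set X := 2 ^+ s * q ^+ H in X0 XL pXL *.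
have -> : 2 * 2 ^+ s * q ^+ H = 2 * X by rewrite mulrA.
have -> : 2 * 2 ^+ s * (q * q ^+ H) = (2 - p) * X.
  by rewrite /X /q; field.
lra.
Qed.

End Exploration.

(** * From averages to the law of the words *)

Lemma mean_tuple (R : realType) (A : finType) m (f : seq A -> R) :
  mean m f = #|A|%:R ^- m * \sum_(u : m.-tuple A) f u.
Proof.
elim: m f => [|m IH] f /=.
  rewrite expr0 invr1 mul1r (big_pred1 [tuple])// => u.
  by apply/esym/eqP; rewrite [u]tuple0; apply: val_inj.
under eq_bigr do rewrite IH.
rewrite -mulr_sumr mulrA exprS invfM; congr (_ * _).
rewrite pair_big /= [RHS](reindex (fun p : A * m.-tuple A => [tuple of p.1 :: p.2])) //=.
exists (fun u : m.+1.-tuple A => (thead u, [tuple of behead u])).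
- by move=> [c u] _ /=; congr (_, _); apply: val_inj.
- by move=> u _ /=; rewrite -tuple_eta.
Qed.

Lemma measure_bigsetU_le d (T : measurableType d) (R : realType)
    (mu : {measure set T -> \bar R}) (I : Type) (r : seq I) (Q : pred I)
    (F : I -> set T) : (forall i, measurable (F i)) ->
  (mu (\big[setU/set0]_(i <- r | Q i) F i) <= \sum_(i <- r | Q i) mu (F i))%E.
Proof.
move=> mF; elim: r => [|i r IH]; first by rewrite !big_nil measure0.
rewrite !big_cons; case: ifP => // _.
apply: (@le_trans _ _ (mu (F i) + mu (\big[setU/set0]_(j <- r | Q j) F j))%E).
  by apply: measureU2 => //; exact: bigsetU_measurable.
exact: leeD2l.
Qed.

Section RandomWordLaw.
Context {d : measure_display} {T : measurableType d} {R : realType}.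
Context {P : probability T R} {A : finType}.
Context {etax etay : nat -> T -> A}.
Hypothesis (hw : uniform_independent_words P etax etay).

Let xword m t := word (etax^~ t) m.
Let yword n t := word (etay^~ t) n.

Let cylinder (u v : seq A) : set T :=
  [set t | xword (size u) t = u /\ yword (size v) t = v].

Let cylinderE (c : A) (u v : seq A) : cylinder u v =
  \bigcap_(i in [set` [fset i in [seq inl i | i <- iota 0 (size u)] ++
                                 [seq inr j | j <- iota 0 (size v)]]%fset])
   (letters etax etay i @^-1`
      [set match i with inl i => nth c u i | inr j => nth c v j end]).
Proof.
apply/seteqP; split => t /=.
  move=> [xu yv] [i|j] /=; rewrite !inE => /orP[] /mapP[k + []] //.
    rewrite mem_iota => /= ki ->; rewrite -[in RHS]xu (nth_map 0%N) ?size_iota//.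
    by rewrite nth_iota.
  rewrite mem_iota => /= kj ->; rewrite -[in RHS]yv (nth_map 0%N) ?size_iota//.
  by rewrite nth_iota.
move=> h; split.
  apply: (@eq_from_nth _ c) => [|i]; rewrite size_map size_iota// => iu.
  rewrite (nth_map 0%N) ?size_iota// nth_iota// add0n; apply: (h (inl i)).
  by rewrite /= !inE map_f// mem_iota.
apply: (@eq_from_nth _ c) => [|j]; rewrite size_map size_iota// => jv.
rewrite (nth_map 0%N) ?size_iota// nth_iota// add0n; apply: (h (inr j)).
by rewrite /= !inE orbC map_f// mem_iota.
Qed.

Let measurable_cylinder (c : A) (u v : seq A) : measurable (cylinder u v).
Proof.
rewrite (cylinderE c); apply: fin_bigcap_measurable => // i _.
by case: hw => + _ _; apply.
Qed.

Let probability_cylinder (c : A) (u v : seq A) :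
  P (cylinder u v) = (#|A|%:R ^- (size u + size v))%:E.
Proof.
case: hw => _ unif ind; rewrite (cylinderE c) ind.
under eq_bigr do rewrite unif.
rewrite prodEFin big_const_seq count_predT iter_mulr_1 exprVn.
rewrite card_fseq undup_id ?size_cat ?size_map ?size_iota//.
rewrite cat_uniq !map_inj_uniq ?iota_uniq//= ?andbT; try by move=> ? ? [].
by apply/hasP => -[_ /mapP[j _ ->] /mapP[]].
Qed.

Let word_event_union (F : seq A -> seq A -> bool) (m n : nat) :
  [set t | F (xword m t) (yword n t)] =
  \big[setU/set0]_(p : m.-tuple A * n.-tuple A | F p.1 p.2) cylinder p.1 p.2.
Proof.
have sx t : size (xword m t) == m by rewrite size_map size_iota.
have sy t : size (yword n t) == n by rewrite size_map size_iota.
rewrite -bigcup_seq_cond; apply/seteqP; split => t /=.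
  move=> Ft; exists (Tuple (sx t), Tuple (sy t)) => /=.
    by rewrite mem_index_enum.
  by rewrite /cylinder /= (eqP (sx t)) (eqP (sy t)).
by move=> [[u v] /= /andP[_ Fuv]] []; rewrite !size_tuple => -> ->.
Qed.

Lemma measurable_word_event (F : seq A -> seq A -> bool) (m n : nat) : A ->
  measurable [set t | F (word (etax^~ t) m) (word (etay^~ t) n)].
Proof.
move=> c; rewrite word_event_union; apply: bigsetU_measurable => p _.
exact: measurable_cylinder.
Qed.

Lemma probability_word_event (F : seq A -> seq A -> bool) (m n : nat) : A ->
  (P [set t | F (word (etax^~ t) m) (word (etay^~ t) n)] <=
   (mean m (fun u => mean n (fun v => (F u v)%:R)))%:E)%E.
Proof.
move=> c; rewrite word_event_union.
apply: le_trans (measure_bigsetU_le _ _ _ _) _ => [p|].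
  exact: measurable_cylinder.
rewrite (eq_bigr (fun=> (#|A|%:R ^- (m + n))%:E)) => [|[u v] _]; last first.
  by apply: etrans (probability_cylinder c u v) _; rewrite !size_tuple.
rewrite sumEFin lee_fin mean_tuple.
under [in leRHS]eq_bigr do rewrite mean_tuple.
rewrite -mulr_sumr pair_big /= mulrA -invfM -exprD mulr_sumr big_mkcond /=.
by apply: ler_sum => p _; case: (F _ _); rewrite ?mulr1// mulr0.
Qed.

End RandomWordLaw.

(** Borel-Cantelli; the sum is bounded by telescoping, as
    1 / n^2 <= 2 (1 / n - 1 / (n + 1)). *)
Lemma ae_eventually_notin d (T : measurableType d) (R : realType)
    (P : probability T R) (F : nat -> set T) (c : R) (N : nat) :
  0 <= c -> (forall n, measurable (F n)) ->
  (forall n, (N < n)%N -> (P (F n) <= (c / n%:R ^+ 2)%:E)%E) ->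
  {ae P, forall t, \forall n \near \oo, ~ F n t}.
Proof.
move=> c0 mF PF.
(* The bound says nothing about the first events, which are dropped. *)
pose G n := if (N < n)%N then F n else set0.
have mG n : measurable (G n) by rewrite /G; case: ifP.
have PG n : (P (G n.+1) <= (2 * c * (n.+1%:R^-1 - n.+2%:R^-1))%:E)%E.
  have pos : 0 <= 2 * c * (n.+1%:R^-1 - n.+2%:R^-1).
    by rewrite !mulr_ge0// subr_ge0 lef_pV2 ?posrE// ler_nat.
  rewrite /G; case: ifP => [Nn|_]; last by rewrite measure0 lee_fin.
  apply: le_trans (PF _ Nn) _; rewrite lee_fin.
  have n0 : 0 <= n%:R :> R by [].
  have -> : n.+2%:R = n%:R + 2 :> R by rewrite -addn2 natrD.
  have -> : n.+1%:R = n%:R + 1 :> R by rewrite natr1.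
  rewrite -subr_ge0.
  have -> : 2 * c * ((n%:R + 1)^-1 - (n%:R + 2)^-1) - c / (n%:R + 1) ^+ 2 =
     c * n%:R / ((n%:R + 1) ^+ 2 * (n%:R + 2)).
    by field; apply/andP; split; lra.
  by rewrite divr_ge0 ?mulr_ge0 ?exprn_ge0 ?addr_ge0.
have : P (lim_sup_set G) = 0.
  apply: lim_sup_set_cvg0 => //.
  apply: (@le_lt_trans _ _ (2 * c)%:E); last exact: ltry.
  apply: lime_le; first by apply: is_cvg_nneseries => n _ _; exact: measure_ge0.
  apply: nearW => -[|n]; first by rewrite big_geq// lee_fin mulr_ge0.
  rewrite big_nat_recl//= {1}/G ltn0 measure0 add0e.
  apply: (@le_trans _ _ (\sum_(0 <= i < n) (2 * c * (i.+1%:R^-1 - i.+2%:R^-1))%:E)%E).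
    by apply: lee_sum => i _; exact: PG.
  rewrite sumEFin lee_fin -mulr_sumr.
  have -> : \sum_(0 <= i < n) (i.+1%:R^-1 - i.+2%:R^-1) = 1 - n.+1%:R^-1 :> R.
    rewrite -[LHS]opprK -sumrN.
    under eq_bigr do rewrite opprB.
    by rewrite (telescope_sumr (fun i => i.+1%:R^-1))// invr1 opprB.
  rewrite ler_piMr ?mulr_ge0// gerBl invr_ge0//.
move=> G0; exists (lim_sup_set G); split => //.
  by apply: bigcap_measurable => // n _; apply: bigcup_measurable.
move=> t /= nF n _; apply: contrapT => nG; apply: nF.
exists (maxn n N.+1) => // j /=; rewrite geq_max => /andP[nj Nj] Fj.
by apply: nG; exists j => //; rewrite /G Nj.
Qed.

(** * Growth of the normalization *)

Section ScaleAsymptotics.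
Context {R : realType}.
Implicit Types (a b c : R).

Lemma near_ge_ln c : \forall n \near \oo, c <= ln (n%:R : R).
Proof.
near=> n; rewrite -[c]expRK ler_ln ?posrE ?expR_gt0//.
  by near: n; exact: nbhs_infty_ger.
by rewrite ltr0n; near: n; exact: nbhs_infty_gt.
Unshelve. all: by end_near. Qed.

Lemma near_ge_powR b c : 0 < b -> \forall n \near \oo, c <= (n%:R : R) `^ b.
Proof.
move=> b0; near=> n.
have n0 : 0 < (n%:R : R) by rewrite ltr0n; near: n; exact: nbhs_infty_gt.
rewrite /powR gt_eqF//; apply: le_trans (expR_ge1Dx _).
have : c <= b * ln n%:R; last by lra.
rewrite mulrC -ler_pdivrMr//; near: n; exact: near_ge_ln.
Unshelve. all: by end_near. Qed.

(** From ln y < y at y = n^(b/2), since n^(b/2) eventually exceeds any constant. *)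
Lemma near_ln_le_powR b c : 0 < b -> 0 < c ->
  \forall n \near \oo, ln (n%:R : R) <= c * n%:R `^ b.
Proof.
move=> b0 c0; have b20 : 0 < b / 2 by rewrite divr_gt0.
near=> n.
have n0 : 0 < (n%:R : R) by rewrite ltr0n; near: n; exact: nbhs_infty_gt.
set y := (n%:R : R) `^ (b / 2).
have y0 : 0 < y by rewrite powR_gt0.
have -> : (n%:R : R) `^ b = y * y.
  by rewrite -powRD ?(gt_eqF n0) ?implybT//; congr (_ `^ _); field.
have lny : ln n%:R <= (b / 2)^-1 * y.
  by rewrite -ler_pdivrMl ?invr_gt0// invrK -ln_powR ltW// ln_sublinear.
apply: le_trans lny _; rewrite mulrA ler_pM2r//.
rewrite [leRHS]mulrC -ler_pdivrMr// /y; near: n; exact: near_ge_powR.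
Unshelve. all: by end_near. Qed.

Lemma near_powR_le b c : b < 1 -> 0 < c ->
  \forall n \near \oo, (n%:R : R) `^ b <= c * n%:R.
Proof.
move=> b1 c0; near=> n.
have n0 : 0 < (n%:R : R) by rewrite ltr0n; near: n; exact: nbhs_infty_gt.
rewrite [X in c * X](_ : _ = n%:R `^ (1 - b) * n%:R `^ b); last first.
  by rewrite -powRD ?(gt_eqF n0) ?implybT// subrK powRr1// ltW.
rewrite mulrA ler_peMl ?powR_ge0// mulrC -ler_pdivrMr//.
by near: n; apply: near_ge_powR; rewrite subr_gt0.
Unshelve. all: by end_near. Qed.

Lemma near_powR_le_scale a : a < 1 ->
  \forall n \near \oo, (n%:R : R) `^ a <= scale a n.
Proof.
move=> a1; near=> n; rewrite /scale; case: (leP a 2^-1) => // a2.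
have n1 : 1 <= (n%:R : R) by rewrite ler1n; near: n; exact: nbhs_infty_gt.
apply: (@le_trans _ _ (n%:R `^ 2^-1)); first exact: ler_powR.
rewrite powR12_sqrt ?ler_wsqrtr ?ler_peMr ?(le_trans ler01 n1)//.
by near: n; exact: near_ge_ln.
Unshelve. all: by end_near. Qed.

Lemma near_powR_le_small_scale a c : a <= 2^-1 -> 0 < c ->
  \forall n \near \oo, (n%:R : R) `^ a <= c * scale a n.
Proof.
move=> a2 c0; near=> n; rewrite /scale a2.
have n1 : 1 <= (n%:R : R) by rewrite ler1n; near: n; exact: nbhs_infty_gt.
apply: (@le_trans _ _ (n%:R `^ 2^-1)); first exact: ler_powR.
have n0 : 0 <= (n%:R : R) by exact: le_trans n1.
rewrite powR12_sqrt// -[c in leRHS]gtr0_norm// -sqrtr_sqr -sqrtrM ?sqr_ge0//.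
apply: ler_wsqrtr; rewrite mulrCA ler_peMr// mulrC -ler_pdivrMr ?exprn_gt0//.
by near: n; exact: near_ge_ln.
Unshelve. all: by end_near. Qed.

Lemma near_sqrt_le_scale a :
  \forall n \near \oo, Num.sqrt (n%:R * ln n%:R) <= scale a n :> R.
Proof.
rewrite /scale; case: (leP a 2^-1) => a2; first exact: nearW.
near=> n; have n0 : 0 < (n%:R : R) by rewrite ltr0n; near: n; exact: nbhs_infty_gt.
have -> : (n%:R : R) `^ a = Num.sqrt (n%:R `^ a ^+ 2).
  by rewrite sqrtr_sqr ger0_norm// powR_ge0.
apply: ler_wsqrtr; rewrite expr2 -powRD ?(gt_eqF n0) ?implybT//.
have -> : a + a = 1 + (a * 2 - 1) by ring.
rewrite powRD ?(gt_eqF n0) ?implybT// powRr1 ?(ltW n0)// ler_pM2l//.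
rewrite -[leRHS]mul1r; near: n; apply: near_ln_le_powR => //.
by move: a2; lra.
Unshelve. all: by end_near. Qed.

Lemma near_scale_le a c : a < 1 -> 0 < c ->
  \forall n \near \oo, scale a n <= c * n%:R.
Proof.
move=> a1 c0; near=> n; rewrite /scale; case: (leP a 2^-1) => a2; last first.
  by near: n; exact: near_powR_le.
have n0 : 0 < (n%:R : R) by rewrite ltr0n; near: n; exact: nbhs_infty_gt.
have cn : 0 <= c * n%:R by rewrite mulr_ge0// ltW.
rewrite -[leRHS]ger0_norm// -sqrtr_sqr; apply: ler_wsqrtr.
rewrite exprMn [n%:R ^+ 2]expr2 mulrCA ler_pM2l// -[X in _ * X]powRr1 ?(ltW n0)//.
by near: n; apply: near_ln_le_powR => //; rewrite exprn_gt0.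
Unshelve. all: by end_near. Qed.

Lemma near_ge_scale a c : 0 < a -> a < 1 -> \forall n \near \oo, c <= scale a n.
Proof.
move=> a0 a1; near=> n; apply: (@le_trans _ _ (n%:R `^ a)).
  by near: n; exact: near_ge_powR.
by near: n; exact: near_powR_le_scale.
Unshelve. all: by end_near. Qed.

End ScaleAsymptotics.

(** * Choice of the parameters *)

Section Tail.
Context {R : realType} {A : finType}.
Hypothesis A2 : (2 <= #|A|)%N.
Local Notation K := (#|A|%:R : R).

Let K2 : 2 <= K. Proof. by rewrite (ler_nat _ 2). Qed.
Let K0 : 0 < K. Proof. exact: lt_le_trans K2. Qed.

(** 1 - exp(- theta) >= theta - theta^2 follows from exp(theta) >= 1 + theta,
    because (1 + theta)(1 - theta + theta^2) = 1 + theta^3. *)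
Lemma rate_expR (theta : R) : 0 <= theta ->
  rate (A := A) (expR theta) <= expR (- (theta - theta ^+ 2) / K).
Proof.
move=> t0; rewrite /rate.
apply: le_trans (expR_ge1Dx _); rewrite lerD2l mulNr lerN2 ler_pM2r ?invr_gt0//.
suff : (expR theta)^-1 <= 1 - theta + theta ^+ 2 by lra.
have e1 : 1 + theta <= expR theta by exact: expR_ge1Dx.
have t1 : 0 < 1 + theta by lra.
apply: (@le_trans _ _ (1 + theta)^-1).
  by rewrite lef_pV2 ?posrE// (lt_le_trans t1).
rewrite -(ler_pM2l t1) mulfV ?gt_eqF//.
have -> : (1 + theta) * (1 - theta + theta ^+ 2) = 1 + theta ^+ 3 by ring.
by rewrite lerDl exprn_ge0.
Qed.

(** [mean_miss_blocks] at E = exp(theta), theta = 2 S / n: then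
    n theta^2 = 4 ln n and theta S = 2 ln n.  The greedy factor is at most
    exp(4 ln n + theta X), where X is the number of letters by which [m] falls
    short of n K.  The mismatches contribute exp(- theta M s), which is at most
    exp(- 6 ln n - theta X) under the hypothesis on X + 3 S.  The last
    hypothesis makes the number n / M of blocks so large that the event of too
    few occasions is negligible. *)
Lemma mean_miss_tail (k n m s : nat) (X : R) :
  let M : R := k.+1%:R in
  let p : R := K ^- (k.+1).*2 in
  let S : R := Num.sqrt (n%:R * ln n%:R) in
  (0 < n)%N -> 2 * S <= n%:R ->
  n%:R * K - X <= m%:R -> 0 <= X ->
  X + 3 * S <= M * s%:R ->
  6 * S + X + s%:R + 1 <= p / 2 * (n%:R / M) ->
  mean (A := A) m (miss s [::] n) <= 2 / n%:R ^+ 2 :> R.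
Proof.
move=> M p S n_gt0 Sn mX X0 XS skips.
have n0 : 0 < (n%:R : R) by rewrite ltr0n.
have M1 : 1 <= M by rewrite ler1n.
have M0 : 0 < M by exact: lt_le_trans M1.
have lnn0 : 0 <= ln (n%:R : R) by rewrite ln_ge0// ler1n.
have S0 : 0 <= S by exact: sqrtr_ge0.
have S2 : S ^+ 2 = n%:R * ln n%:R by rewrite sqr_sqrtr// mulr_ge0// ltW.
set theta := 2 * S / n%:R.
have t0 : 0 <= theta by rewrite divr_ge0 ?mulr_ge0// ltW.
have t1 : theta <= 1 by rewrite ler_pdivrMr// mul1r.
have tS : theta * S = 2 * ln n%:R.
  have -> : theta * S = 2 * S ^+ 2 / n%:R by rewrite /theta expr2; ring.
  by rewrite S2; field; rewrite gt_eqF.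
have nt2 : n%:R * theta ^+ 2 = 4 * ln n%:R.
  rewrite /theta expr_div_n exprMn S2; field; rewrite gt_eqF//.
have p0 : 0 < p by rewrite invr_gt0 exprn_gt0.
have p1 : p <= 1.
  by rewrite invf_le1 ?exprn_gt0// exprn_ege1// (le_trans _ K2)// ler1n.
set H := (n %/ k.+1)%N.
have HM : n%:R / M - 1 <= H%:R.
  rewrite lerBlDr ler_pdivrMr// natr1 -natrM ler_nat ltnW//.
  by rewrite /H ltn_ceil.
have E1 : 1 <= expR theta by rewrite -[1]expR0 ler_expR.
have := mean_miss_blocks A2 E1 k (n %% k.+1) H s m.
rewrite /= -/p -divn_eq => /le_trans; apply.
have lnS : 2 * ln n%:R <= S by rewrite -tS ler_piMl.
set U := (theta - theta ^+ 2) / K.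
have rm : rate (A := A) (expR theta) ^+ m <= expR (- (m%:R * U)).
  rewrite -mulrN mulrC expRM_natr lerXn2r ?nnegrE ?expR_ge0//.
    by rewrite ltW// rate_gt0.
  by have := rate_expR t0; rewrite mulNr.
have tt2 : 0 <= theta - theta ^+ 2 by rewrite subr_ge0 expr2 ler_piMl.
have drift : n%:R * theta - m%:R * U <= 4 * ln n%:R + X * theta.
  have : (n%:R * K - X) * U <= m%:R * U.
    by rewrite ler_wpM2r// divr_ge0// ltW.
  have -> : (n%:R * K - X) * U = n%:R * theta - n%:R * theta ^+ 2 - X * U.
    by rewrite /U; field; rewrite gt_eqF.
  have : X * U <= X * theta.
    rewrite ler_wpM2l// ler_pdivrMr//.
    apply: (@le_trans _ _ theta); first by rewrite gerBl sqr_ge0.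
    by rewrite ler_peMr// (le_trans _ K2)// ler1n.
  rewrite nt2; lra.
have target : expR (- (2 * ln n%:R)) = (n%:R ^+ 2)^-1 :> R.
  by rewrite expRN expRM_natl lnK ?posrE.
rewrite -expRM_natl -expRM_natl -expRN mulrDr mulrDl.
have -> : 2 / n%:R ^+ 2 = expR (- (2 * ln n%:R)) + expR (- (2 * ln n%:R)) :> R.
  by rewrite target; ring.
apply: lerD.
  rewrite -expRD; apply: (@le_trans _ _ (expR (n%:R * theta -
      (k.+1 * s)%:R * theta) * expR (- (m%:R * U)))).
    by rewrite ler_wpM2l// expR_ge0.
  rewrite -expRD ler_expR natrM -/M.
  have : (X + 3 * S) * theta <= M * s%:R * theta by rewrite ler_wpM2r.
  by rewrite mulrDl -mulrA [S * _]mulrC tS; lra.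
have two : (2 : R) ^+ s <= expR s%:R.
  rewrite -[s%:R]mulr1 expRM_natl lerXn2r ?nnegrE ?expR_ge0//.
  by have := expR_ge1Dx (1 : R); lra.
have rare : (1 - p / 2) ^+ H <= expR (- (p / 2 * H%:R)).
  rewrite -[in leRHS]mulNr expRM_natr lerXn2r ?nnegrE ?expR_ge0//; first by lra.
  exact: expR_ge1Dx.
apply: (@le_trans _ _ (expR (n%:R * theta) *
    (expR s%:R * expR (- (p / 2 * H%:R))) * expR (- (m%:R * U)))).
  have q0 : 0 <= 1 - p / 2 by lra.
  rewrite ler_pM ?mulr_ge0 ?expR_ge0 ?exprn_ge0 ?(ltW (rate_gt0 _ _))//.
  by rewrite ler_wpM2l ?expR_ge0// ler_pM ?exprn_ge0.
rewrite -!expRD ler_expR.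
have : p / 2 * (n%:R / M - 1) <= p / 2 * H%:R by rewrite ler_wpM2l// divr_ge0// ltW.
have : X * theta <= X by rewrite ler_piMr.
clearbody p S M theta U; lra.
Qed.

End Tail.

(** * Limits of the normalized deficit *)

Section Limits.
Context {R : realType}.

Lemma limn_esup_le_near (u : nat -> \bar R) (l : \bar R) :
  (\forall n \near \oo, (u n <= l)%E) -> (limn_esup u <= l)%E.
Proof.
move=> ul; apply: (@le_trans _ _ (ereal_sup (u @` [set n | (u n <= l)%E]))).
  by apply: ereal_inf_lbound; exists [set n | (u n <= l)%E].
by apply: ge_ereal_sup => _ [n /= un <-].
Qed.

Lemma limn_einf_ge_near (u : nat -> R) (l : R) :
  (forall e, 0 < e -> \forall n \near \oo, l - e <= u n) ->
  (l%:E <= limn_einf (fun n => (u n)%:E))%E.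
Proof.
move=> ul; rewrite /limn_einf leeNr; apply/lee_addgt0Pr => e e0.
apply: limn_esup_le_near; near=> n.
have : l - e <= u n by near: n; exact: ul.
by rewrite -!EFinN -EFinD lee_fin; lra.
Unshelve. all: by end_near. Qed.

End Limits.

Section DeficitBounds.
Context {R : realType}.
Variables (a x beta : R) (k : nat).
Hypotheses (a0 : 0 < a) (a1 : a < 1) (x0 : 0 < x) (beta0 : 0 <= beta).
Hypothesis k0 : (0 < k)%N.

Local Notation m := (endpoint k a x).

Lemma endpoint_ge n : n%:R * k%:R - (x * n%:R `^ a + 1) <= (m n)%:R.
Proof.
have := truncnS_gt (n%:R * k%:R - x * n%:R `^ a); rewrite -/(m n) -natr1; lra.
Qed.

Lemma near_endpoint_le :
  \forall n \near \oo, (m n)%:R <= n%:R * k%:R - x * n%:R `^ a :> R.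
Proof.
near=> n; rewrite truncn_le subr_ge0.
apply: (@le_trans _ _ (x * (x^-1 * n%:R))).
  by rewrite ler_pM2l//; near: n; apply: near_powR_le; rewrite // invr_gt0.
by rewrite mulVKf ?gt_eqF// ler_peMr// ler1n.
Unshelve. all: by end_near. Qed.

Lemma near_scale_gt0 : \forall n \near \oo, 0 < scale a n.
Proof.
near=> n; apply: (@lt_le_trans _ _ 1) => //.
by near: n; exact: near_ge_scale.
Unshelve. all: by end_near. Qed.

Lemma near_normalized_deficit_ge (omega : nat -> nat -> bool) (e : R) : 0 < e ->
  \forall n \near \oo, (if a <= 2^-1 then 0 else - (beta * x)) - e <=
    normalized_deficit k a x beta omega n.
Proof.
move=> e0.
(* For a <= 1/2, n^a is negligible with respect to the scale; this c makes
   beta x n^a cost less than e / 2 times the scale. *)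
pose c := e / (2 * (beta * x + 1)).
have bx0 : 0 <= beta * x by rewrite mulr_ge0// ltW.
have c0 : 0 < c by rewrite divr_gt0// mulr_gt0// ltr_wpDl.
have powS : \forall n \near \oo, n%:R `^ a <=
    (if a <= 2^-1 then c else 1) * scale a n.
  case: (leP a 2^-1) => a2; first exact: near_powR_le_small_scale.
  by apply: filterS (near_powR_le_scale a1) => n; rewrite mul1r.
near=> n; have g0 : 0 < scale a n by near: n; exact: near_scale_gt0.
rewrite /normalized_deficit ler_pdivlMr//.
have := optimal_score_le omega (m n) n beta0.
have : n%:R `^ a <= (if a <= 2^-1 then c else 1) * scale a n by near: n.
have big : 2 * beta / e <= scale a n by near: n; exact: near_ge_scale.
have {big} : beta <= e / 2 * scale a n.
  have -> : beta = e / 2 * (2 * beta / e) by field; rewrite gt_eqF.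
  by rewrite ler_wpM2l// divr_ge0// ltW.
have := ler_wpM2l beta0 (endpoint_ge n).
set g := scale a n; set y := n%:R `^ a; set M := (m n)%:R.
move=> mn bg yg L.
have : beta * x * y <= beta * x * ((if a <= 2^-1 then c else 1) * g).
  by rewrite ler_wpM2l.
have eg : 0 < e * g by rewrite mulr_gt0.
case: (leP a 2^-1) => a2; first last.
  by clear -mn bg L eg; clearbody g y M; lra.
have : beta * x * (c * g) <= e / 2 * g.
  rewrite mulrA ler_pM2r//.
  have -> : e / 2 = (beta * x + 1) * c.
    by rewrite /c; field; rewrite gt_eqF// ltr_wpDl.
  by rewrite ler_pM2r// lerDl.
by clear -mn bg L eg; clearbody g y M; lra.
Unshelve. all: by end_near. Qed.

Lemma normalized_deficit_le (A : finType) (u v : nat -> A) (n s : nat) (B : R) :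
  aligned s (word u (m n)) (word v n) ->
  0 < scale a n -> (m n)%:R <= n%:R * k%:R - x * n%:R `^ a :> R ->
  s%:R <= B * scale a n ->
  normalized_deficit k a x beta (environment u v) n <=
  (if a <= 2^-1 then B else B - beta * x).
Proof.
move=> al g0 mn sB; have := optimal_score_ge beta al.
rewrite /normalized_deficit ler_pdivrMr//.
have := ler_wpM2l beta0 mn; rewrite mulrBr mulrA.
set M := (m n)%:R; set L := optimal_score _ _ _ _ => bM HL.
have : beta * x * n%:R `^ a >= 0.
  by rewrite mulr_ge0 ?powR_ge0// mulr_ge0// ltW.
move: sB; rewrite /scale; case: (leP a 2^-1) => a2 sB y0.
  set g := Num.sqrt _ in sB *; clear -bM HL sB y0; lra.
set y := n%:R `^ a in sB y0 bM *; clear -bM HL sB y0; lra.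
Qed.

End DeficitBounds.

(** The block length M is at least (x + 5) / c, so that M times the number
    c g(n) of mismatches covers the shortage x n^a and the 3 sqrt(n ln n) that
    pays for a summable probability, both measured against g(n). *)
Lemma near_mean_miss (R : realType) (A : finType) (a x c : R) :
  (2 <= #|A|)%N -> 0 < a -> a < 1 -> 0 < x -> 0 < c ->
  \forall n \near \oo,
    mean (A := A) (endpoint #|A| a x n)
      (miss (Num.truncn (c * scale a n)) [::] n) <= 2 / n%:R ^+ 2 :> R.
Proof.
move=> A2 a0 a1 x0 c0.
pose k := Num.truncn ((x + 5) / c); pose M : R := k.+1%:R.
have M0 : 0 < M by rewrite ltr0n.
have Mc : x + 5 <= M * c.
  by rewrite -ler_pdivrMr// ltW// truncnS_gt.
pose p : R := #|A|%:R ^- (k.+1).*2.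
have A0 : 0 < #|A|%:R :> R by rewrite ltr0n ltnW.
have p0 : 0 < p by rewrite invr_gt0 exprn_gt0.
(* A multiple d n of n with (8 + x + c) d n = p/2 (n / M). *)
pose d := p / 2 / M / (8 + x + c).
have d0 : 0 < d by rewrite !divr_gt0// !addr_gt0.
near=> n.
have n1 : (0 < n)%N by near: n; exact: nbhs_infty_gt.
have n0 : 0 < n%:R :> R by rewrite ltr0n.
have pg : n%:R `^ a <= scale a n by near: n; exact: near_powR_le_scale.
have sg : Num.sqrt (n%:R * ln n%:R) <= scale a n.
  by near: n; exact: near_sqrt_le_scale.
have gn : scale a n <= 2^-1 * n%:R.
  by near: n; apply: near_scale_le; rewrite // invr_gt0.
have gd : scale a n <= d * n%:R by near: n; exact: near_scale_le.
have gM : M + 2 <= scale a n by near: n; exact: near_ge_scale.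
have xg : x * n%:R `^ a <= x * scale a n by rewrite ler_pM2l.
have cg0 : 0 <= c * scale a n.
  by rewrite mulr_ge0// ltW// (lt_le_trans _ gM)// ltr_wpDr.
have sle : (Num.truncn (c * scale a n))%:R <= c * scale a n by rewrite truncn_le.
have sge := truncnS_gt (c * scale a n).
rewrite -natr1 in sge.
apply: (@mean_miss_tail _ _ A2 k _ _ _ (x * n%:R `^ a + 1)) => //.
- by lra.
- exact: endpoint_ge.
- by rewrite addr_ge0// mulr_ge0 ?powR_ge0// ltW.
- rewrite -/M; set s := (Num.truncn _)%:R in sle sge *.
  have : M * (c * scale a n - 1) <= M * s.
    by rewrite ler_wpM2l ?(ltW M0)//; lra.
  have : (x + 5) * scale a n <= M * c * scale a n.
    by rewrite ler_wpM2r//; lra.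
  by move: xg sg gM M0; clear; clearbody M s; lra.
- rewrite -/M -/p; set s := (Num.truncn _)%:R in sle sge *.
  have -> : p / 2 * (n%:R / M) = (8 + x + c) * (d * n%:R).
    by rewrite /d; field; rewrite !gt_eqF// !addr_gt0.
  apply: (@le_trans _ _ ((8 + x + c) * scale a n)); last first.
    by rewrite ler_wpM2l// !addr_ge0// ltW.
  by move: xg sg gM sle M0; clear; clearbody M s; lra.
Unshelve. all: by end_near. Qed.

Unset Implicit Arguments.

Theorem theorem2p6 (R : realType) (A : finType) (hA : (2 <= #|A|)%N)
  (d : measure_display) (T : measurableType d) (P : probability T R)
  (etax etay : nat -> T -> A)
  (heta : uniform_independent_words P etax etay)
  (a x beta : R) (ha0 : 0 < a) (ha1 : a < 1) (hx : 0 < x) (hbeta : 0 <= beta) :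
  {ae P, forall t : T,
    let omega := environment (fun i => etax i t) (fun j => etay j t) in
    let D := fun n : nat => (normalized_deficit #|A| a x beta omega n)%:E in
    (limn_esup D <=
      (if a <= 2^-1
       then Num.sqrt 2 / (#|A|%:R - 1) - #|A|%:R^-1
       else (#|A|%:R * (#|A|%:R - 1))^-1 - beta * x)%:E)%E
    /\
    ((if a <= 2^-1 then 0 else - (beta * x))%:E <= limn_einf D)%E}.
Proof.
have A0 : (0 < #|A|)%N by exact: ltnW.
have K2 : 2 <= #|A|%:R :> R by rewrite (ler_nat _ 2).
pose B : R := if a <= 2^-1 then Num.sqrt 2 / (#|A|%:R - 1) - #|A|%:R^-1
              else (#|A|%:R * (#|A|%:R - 1))^-1.
have B0 : 0 < B.
  rewrite /B; case: ifP => _; last by rewrite invr_gt0 mulr_gt0//; lra.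
  have K0 : 0 < #|A|%:R :> R by lra.
  have K1 : 0 < #|A|%:R - 1 :> R by lra.
  rewrite subr_gt0 ltr_pdivlMr//.
  apply: (@lt_le_trans _ _ 1); first by rewrite mulrC ltr_pdivrMr//; lra.
  by rewrite -[leLHS]sqrtr1 ler_wsqrtr// ler1n.
pose s n := Num.truncn (B * scale a n).
pose bad n (u v : seq A) := ~~ `[< aligned (s n) u v >].
pose F n := [set t | bad n (word (etax^~ t) (endpoint #|A| a x n))
                           (word (etay^~ t) n)].
have /card_gt0P[c _] := A0.
have [N _ HN] := near_mean_miss hA ha0 ha1 hx B0.
have aeF : {ae P, forall t, \forall n \near \oo, ~ F n t}.
  apply: (@ae_eventually_notin _ _ _ P F 2 N) => // n.
    exact: (measurable_word_event heta).
  move=> Nn; apply: le_trans (probability_word_event heta _ _ _ c) _.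
  by rewrite lee_fin; exact: HN (ltnW Nn).
apply: filterS aeF => t goodF; split; last first.
  by apply: limn_einf_ge_near => e e0; exact: near_normalized_deficit_ge.
apply: limn_esup_le_near; near=> n; rewrite lee_fin.
have -> : (if a <= 2^-1 then Num.sqrt 2 / (#|A|%:R - 1) - #|A|%:R^-1
    else (#|A|%:R * (#|A|%:R - 1))^-1 - beta * x) =
  (if a <= 2^-1 then B else B - beta * x) by rewrite /B; case: ifP.
have g0 : 0 < scale a n by near: n; exact: near_scale_gt0.
apply: (@normalized_deficit_le _ _ _ _ _ hx hbeta _ _ _ _ (s n)) => //.
- have : ~ F n t by near: n.
  by move=> /negP; rewrite negbK => /asboolP.
- by near: n; exact: near_endpoint_le.
- by rewrite truncn_le mulr_ge0 ?ltW.
Unshelve. all: by end_near. Qed.
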